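(* Let $G$ be a connected locatable graph of order $n$. Then $\gamma_{OL}(G)=n$ if and only if $G$ is a half-graph, i.e., if and only if $G$ is isomorphic to $H_k$ for some integer $k\geq 1$.
   Context: All graphs are simple, finite and undirected, and have at least one vertex. The order of a graph is its number of vertices. $N(v)$ denotes the open neighbourhood of a vertex $v$, i.e. the set of vertices adjacent to $v$ (so $v\notin N(v)$). An open neighbourhood locating-dominating set (OLD set) of a graph $G$ is a set $S\subseteq V(G)$ such that every vertex $v\in V(G)$ has a neighbour in $S$ (i.e. $N(v)\cap S\neq\emptyset$), and for any two distinct vertices $v,w\in V(G)$, $N(v)\cap S\neq N(w)\cap S$. A graph is locatable if it has no isolated vertices and no pair of open twins, where open twins are two distinct vertices with the same open neighbourhood; equivalently, a graph is locatable if it admits an OLD set. For a locatable graph $G$, $\gamma_{OL}(G)$ denotes the smallest size of an OLD set of $G$. For an integer $k\geq 1$, the half-graph $H_k$ is the bipartite graph with parts $\{v_1,\ldots,v_k\}$ and $\{w_1,\ldots,w_k\}$ (with $2k$ vertices in total), with an edge between $v_i$ and $w_j$ if and only if $i\leq j$. *)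

(* Defs.v *)
From mathcomp Require Import all_boot.

Set Implicit Arguments.
Unset Strict Implicit.
Unset Printing Implicit Defensive.

(* The empty graph is not excluded here: nonemptiness is a separate hypothesis
   where it is needed. *)
Record sgraph := SGraph {
  vertex :> finType;
  adj : rel vertex;
  adj_sym : symmetric adj;
  adj_irrefl : irreflexive adj
}.

Definition connected (G : sgraph) : Prop := forall x y : G, connect (@adj G) x y.

Definition isomorphic (G H : sgraph) : Prop :=
  exists2 f : G -> H, bijective f & forall x y : G, adj (f x) (f y) = adj x y.

Definition open_nbhd (G : sgraph) (v : G) : {set G} := [set w | adj v w].

Definition open_twins (G : sgraph) (v w : G) : bool :=
  (v != w) && (open_nbhd v == open_nbhd w).

Definition locatable (G : sgraph) : bool :=
  [forall v : G, open_nbhd v != set0] &&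
  [forall v : G, forall w : G, ~~ open_twins v w].

Definition old_set (G : sgraph) (S : {set G}) : bool :=
  [forall v : G, open_nbhd v :&: S != set0] &&
  [forall v : G, forall w : G,
     (v != w) ==> (open_nbhd v :&: S != open_nbhd w :&: S)].

(* Only meaningful when G is locatable, i.e. when [set: G] is an OLD set; see
   gamma_OLP. For other graphs the default value #|G| is junk. *)
Definition gamma_OL (G : sgraph) : nat :=
  #|[arg min_(S < [set: G] | old_set S) #|S|]|.

Lemma locatable_old_setT (G : sgraph) : locatable G = old_set [set: G].
Proof.
rewrite /locatable /old_set; congr (_ && _).
  by apply: eq_forallb => v; rewrite setIT.
apply: eq_forallb => v; apply: eq_forallb => w.
by rewrite !setIT /open_twins negb_and implybE.
Qed.

Lemma old_set_locatable (G : sgraph) (S : {set G}) : old_set S -> locatable G.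
Proof.
case/andP => /forallP dom /forallP sep; apply/andP; split.
  apply/forallP => v; apply: contraNneq (dom v) => ->.
  by rewrite set0I.
apply/forallP => v; apply/forallP => w; apply/negP => /andP [vw /eqP eN].
by have /forallP /(_ w) := sep v; rewrite vw eN eqxx.
Qed.

Lemma gamma_OLP (G : sgraph) : locatable G ->
  (exists2 S : {set G}, old_set S & #|S| = gamma_OL G) /\
  (forall S : {set G}, old_set S -> gamma_OL G <= #|S|).
Proof.
rewrite locatable_old_setT /gamma_OL => oldT.
by case: arg_minnP => // S oldS minS; split=> //; exists S.
Qed.

(* v_i is inl i and w_j is inr j, with indices starting at 0. *)
Definition half_adj (k : nat) : rel ('I_k + 'I_k) := fun x y =>
  match x, y with
  | inl i, inr j => i <= j
  | inr j, inl i => i <= j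
  | _, _ => false
  end.

Lemma half_adj_sym (k : nat) : symmetric (@half_adj k).
Proof. by case=> i [] j. Qed.

Lemma half_adj_irrefl (k : nat) : irreflexive (@half_adj k).
Proof. by case. Qed.

Definition half_graph (k : nat) : sgraph :=
  SGraph (@half_adj_sym k) (@half_adj_irrefl k).

(* Main.v *)
Require Import Defs.
From mathcomp Require Import all_boot.

(** Write N(v) for the open neighbourhood of v, and add a phantom vertex [None]
    with empty neighbourhood.  Deleting x from the full vertex set destroys the
    OLD property exactly when two of the neighbourhoods (phantom one included)
    differ in x only, say N(a) = N(b) + x, where a is a genuine vertex and b
    may be the phantom.  So gamma_OL(G) = n means that every x has such a pair
    (a(x), b(x)): this is [gamma_OL_fullP].

    The converse direction then amounts to exhibiting the pairs in a
    half-graph: N(v_i) = N(v_(i+1)) + w_i and N(w_i) = N(w_(i-1)) + v_i, the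
    phantom replacing v_(i+1) or w_(i-1) when the index is out of range.

    For the direct implication, let A be the adjacency matrix and B the matrix
    whose row x is the indicator of a(x) minus that of b(x).  The equations
    N(a(x)) = N(b(x)) + x say that B A = 1; as A is symmetric, so is B.  Each
    row of B has exactly one entry 1 and at most one entry -1, hence a is an
    involution and b is a partial involution ([upper_involutive],
    [lower_sym]).

    Consequently the a-links and b-links form alternating paths.  Such a path
    w_0, w_1 = a(b(w_0)), ..., w_k, started at a vertex of minimum degree,
    satisfies N(w_j) = {a(w_0), ..., a(w_j)} and N(a(w_j)) = {w_j, ..., w_k}.
    Its vertices thus induce a half-graph closed under adjacency, which is all
    of G by connectedness. *)

Set Implicit Arguments.
Unset Strict Implicit.
Unset Printing Implicit Defensive.

(** * Forced vertices *)

Definition oadj (G : sgraph) : rel (option G) := fun u v =>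
  match u, v with Some x, Some y => adj x y | _, _ => false end.

Lemma oadj_sym (G : sgraph) : symmetric (@oadj G).
Proof. by move=> [x|] [y|] //=; apply: adj_sym. Qed.

(** The equality between natural numbers (rather than booleans) says that the
    union N(a) = N(b) + x is disjoint. *)
Definition forces (G : sgraph) (x a : G) (b : option G) : Prop :=
  forall y : G, adj a y = (y == x) + oadj b (Some y) :> nat.

Lemma forces_old_mem (G : sgraph) (x a : G) (b : option G) (S : {set G}) :
  forces x a b -> old_set S -> x \in S.
Proof.
move=> fab /andP[/forallP dom /forallP sep]; apply/negPn/negP => xS.
(* a and b have the same trace on S, so S fails to dominate a (when b is the
   phantom) or to separate a from b. *)
have same y : y \in S -> adj a y = oadj b (Some y).
  move=> yS; apply: (can_inj oddb); rewrite fab.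
  by case: eqP yS => // ->; rewrite (negPf xS).
case: b fab same => [b|] fab same.
  have ab : a != b.
    by apply/eqP => ab; have := fab x; rewrite eqxx ab /=; case: (adj b x).
  have /forallP/(_ b) := sep a; rewrite ab /= => /eqP; apply.
  apply/setP => y; rewrite !inE.
  by case yS: (y \in S); rewrite ?andbF // same.
have /set0Pn[y] := dom a; rewrite !inE => /andP[ay yS].
by rewrite same in ay.
Qed.

Lemma not_old_forces (G : sgraph) (x : G) : locatable G ->
  ~~ old_set [set~ x] -> exists ab : G * option G, forces x ab.1 ab.2.
Proof.
rewrite locatable_old_setT => /andP[/forallP dom /forallP sep].
rewrite negb_and => /orP[] /forallPn /= [u].
  rewrite negbK => /eqP/setP eu.
  have ux y : adj u y -> y == x.
    by move=> uy; have := eu y; rewrite !inE uy /= => /negbT; rewrite negbK.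
  exists (u, None) => y /=; rewrite addn0; congr nat_of_bool.
  apply/idP/eqP => [/ux/eqP //|->].
  have /set0Pn[z] := dom u; rewrite !inE andbT => uz.
  by rewrite -(eqP (ux _ uz)).
case/forallPn => w; rewrite negb_imply negbK => /andP[uw /eqP/setP euw].
have same y : y != x -> adj u y = adj w y.
  by move=> yx; have := euw y; rewrite !inE yx !andbT.
have xdiff : adj u x != adj w x.
  have /forallP/(_ w) := sep u; rewrite uw /=; apply: contraNneq => exx.
  apply/eqP/setP => y; rewrite !inE !andbT.
  by have [->|/same] := eqVneq y x.
(* Of u and w, the one adjacent to x has the larger neighbourhood. *)
case ux: (adj u x) xdiff => xdiff.
  exists (u, Some w) => y /=; have [->|/same->//] := eqVneq y x.
  by move: xdiff; rewrite ux; case: (adj w x).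
exists (w, Some u) => y /=; have [->|/same->//] := eqVneq y x.
by move: xdiff; rewrite ux; case: (adj w x).
Qed.

Lemma gamma_OL_fullP (G : sgraph) : locatable G ->
  gamma_OL G = #|G| <->
  forall x : G, exists ab : G * option G, forces x ab.1 ab.2.
Proof.
move=> locG; have [[S oldS cardS] minS] := gamma_OLP locG;
split=> [full x|allF].
  apply: not_old_forces => //; apply/negP => /minS.
  by rewrite full cardsC1 leqNgt ltn_predL (cardD1 x).
rewrite -cardS -cardsT; congr #|pred_of_set _|.
apply/setP => x; rewrite in_setT.
by have [[a b] fab] := allF x; apply: forces_old_mem fab oldS.
Qed.

(** * Half-graphs *)

Lemma half_graph_forces (k : nat) (x : half_graph k) :
  exists ab : half_graph k * option (half_graph k), forces x ab.1 ab.2.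
Proof.
have split m n : (m <= n) = (m == n) + (m < n) :> nat by case: ltngtP.
case: x => -[i lti].
  case: i lti => [|i] lti.
    by exists (inr (Ordinal lti), None) => -[] j //=; rewrite addn0 leqn0.
  by exists (inr (Ordinal lti), Some (inr (Ordinal (ltnW lti)))) => -[] j //=.
have [ltSi|leki] := ltnP i.+1 k.
  exists (inl (Ordinal lti), Some (inl (Ordinal ltSi))) => -[] j //=.
  by rewrite split eq_sym.
exists (inl (Ordinal lti), None) => -[] j //=.
by rewrite split eq_sym [i < j]ltnNge -ltnS (leq_trans (ltn_ord j) leki).
Qed.

Lemma isomorphic_forces (G H : sgraph) : isomorphic G H ->
  (forall x : H, exists ab : H * option H, forces x ab.1 ab.2) ->
  forall x : G, exists ab : G * option G, forces x ab.1 ab.2.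
Proof.
move=> [f [g fK gK] fadj] allF x; have [[a b] fab] := allF (f x).
exists (g a, omap g b) => y /=; rewrite -fadj gK fab (can_eq fK).
by case: b {fab} => [b|] //=; rewrite -fadj gK.
Qed.

(** * Forcing pairs form involutions *)

Section ForcingPairs.

Variables (G : sgraph) (a : G -> G) (b : G -> option G).
Hypothesis forced : forall x : G, forces x (a x) (b x).

Lemma oadj_upper (x : G) (u : option G) :
  oadj (Some (a x)) u = (u == Some x) + oadj (b x) u :> nat.
Proof. by case: u => [y|] /=; [apply: forced | case: (b x)]. Qed.

Lemma lower_neq_upper (x : G) : b x != Some (a x).
Proof.
apply/eqP => bx; have := forced x x; rewrite bx eqxx /=.
by case: (adj _ _).
Qed.

(** Symmetry of the inverse B of the adjacency matrix A, with its negative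
    entries moved across: expand A(a(x), a(y)) along row x or along row y. *)
Lemma pairing_sym (x y : G) :
  (a y == x) + (b x == Some y) = (a x == y) + (b y == Some x).
Proof.
have expand u v : adj (a u) (a v) =
    (a v == u) + (b u == Some v) + oadj (b u) (b v) :> nat.
  by rewrite forced oadj_sym oadj_upper addnA [oadj (b v) _]oadj_sym.
have := expand y x; rewrite adj_sym expand oadj_sym.
by move/addIn.
Qed.

Lemma upper_involutive : involutive a.
Proof.
move=> y; have := pairing_sym (a y) y.
rewrite eqxx (negPf (lower_neq_upper y)) addn0.
by case: (a (a y) =P y) => // _; rewrite add1n.
Qed.

Lemma lower_sym (x y : G) : b x = Some y -> b y = Some x.
Proof.
move=> bx; have := pairing_sym x y.
rewrite bx eqxx (inv_eq upper_involutive) eq_sym => /addnI.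
by case: eqP.
Qed.

(** * The alternating path *)

(** In N(a(x)) = N(b(x)) + x take x = a(w): N(w) = N(b(a(w))) + a(w).  If w
    has minimum degree, b(a(w)) cannot be a genuine vertex. *)
Lemma exists_degree_one : 0 < #|G| ->
  exists w : G, forall y : G, adj w y = (y == a w).
Proof.
case/card_gt0P => y0 _.
case: (arg_minnP (fun w : G => #|open_nbhd w|) (erefl (xpredT y0))) => w _ minw.
have Nw := forced (a w); rewrite upper_involutive in Nw.
exists w; case: (b (a w)) Nw => [z|] Nw y; last first.
  by apply/(can_inj oddb); rewrite Nw addn0.
have /proper_card : open_nbhd z \proper open_nbhd w.
  apply/properP; split.
    apply/subsetP => t; rewrite !inE => /= zt.
    by have := Nw t; rewrite /= zt; case: (adj w t) => //; case: (t == _).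
  exists (a w); rewrite inE; have := Nw (a w); rewrite eqxx /=;
    by case: (adj w _); case: (adj z _).
by rewrite ltnNge minw.
Qed.

(** One b-link then one a-link; the end of a path is a fixed point. *)
Definition next (w : G) : G := if b w is Some z then a z else w.

Lemma adj_next (w y : G) : b w ->
  adj (next w) y = (y == a (next w)) + adj w y :> nat.
Proof.
rewrite /next; case bw: (b w) => [z|] // _.
by rewrite forced upper_involutive (lower_sym bw).
Qed.

Lemma adj_upper_next (w y : G) : b w ->
  adj (a w) y = (y == w) + adj (a (next w)) y :> nat.
Proof.
rewrite /next; case bw: (b w) => [z|] // _.
by rewrite upper_involutive forced bw.
Qed.

Variable w0 : G.
Hypothesis adj_w0 : forall y : G, adj w0 y = (y == a w0).

Let W (j : nat) : G := iter j next w0.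

(** Each step raises the degree by one; this both bounds the length of the path
    and shows that its vertices are distinct. *)
Lemma degree_path (j : nat) : (forall i, i < j -> b (W i)) ->
  #|open_nbhd (W j)| = j.+1.
Proof.
elim: j => [_|j IHj bW].
  rewrite -(cards1 (a w0)); congr #|pred_of_set _|.
  by apply/setP => y; rewrite !inE adj_w0.
have {}IHj := IHj (fun i lt_ij => bW i (ltnW lt_ij)).
have Nnext := adj_next _ (bW j (ltnSn j)).
have -> : open_nbhd (W j.+1) = a (W j.+1) |: open_nbhd (W j).
  apply/setP => y; rewrite !inE; apply: (can_inj oddb); rewrite Nnext.
  have := Nnext y; rewrite -/(W j.+1).
  by case: eqP; case: (adj (W j) y); case: (adj _ _).
rewrite cardsU1 IHj inE; have := Nnext (a (W j.+1)); rewrite eqxx.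
by case: (adj (W j) _); case: (adj _ _).
Qed.

Lemma path_ends : exists k, ~~ b (W k) /\ (forall i, i < k -> b (W i)).
Proof.
have exk : exists k, ~~ b (W k).
  have [/existsP[i bi]|] := boolP [exists i : 'I_#|G|, ~~ b (W i)].
    by exists i.
  rewrite negb_exists => /forallP bW.
  have := @degree_path #|G| (fun i lti => negbNE (bW (Ordinal lti))).
  by move=> deg; have := max_card (mem (open_nbhd (W #|G|))); rewrite deg ltnn.
case: (ex_minnP exk) => k bk mink; exists k; split=> // i lti.
by apply/negPn/negP => /mink; rewrite leqNgt lti.
Qed.

Variable k : nat.
Hypothesis path_end : ~~ b (W k).
Hypothesis path_inner : forall i, i < k -> b (W i).

Lemma adj_path (j : nat) (y : G) : j <= k ->
  reflect (exists2 i, i <= j & y = a (W i)) (adj (W j) y).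
Proof.
elim: j => [_|j IHj ltjk].
  rewrite adj_w0; apply: (iffP eqP) => [->|[i]]; first by exists 0.
  by rewrite leqn0 => /eqP->.
have Nnext := adj_next y (path_inner ltjk); rewrite -/(W j.+1) in Nnext.
have -> : adj (W j.+1) y = (y == a (W j.+1)) || adj (W j) y.
  by move: Nnext; case: eqP; case: (adj (W j) y); case: (adj _ _).
apply: (iffP orP) => [[/eqP->|/(IHj (ltnW ltjk))[i leij ->]]|[i]].
- by exists j.+1.
- by exists i => //; apply: leqW.
- rewrite leq_eqVlt => /orP[/eqP->->|leij ey]; first by left.
  by right; apply/(IHj (ltnW ltjk)); exists i.
Qed.

(** Going backwards from the end w_k, where b is the phantom and therefore
    N(a(w_k)) = {w_k}, each step adds the vertex w_j to N(a(w_(j+1))). *)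
Lemma adj_upper_path (j : nat) (y : G) : j <= k ->
  reflect (exists2 i, j <= i <= k & y = W i) (adj (a (W j)) y).
Proof.
move=> lejk; rewrite -(subKn lejk).
elim: (k - j) (leq_subr j k) => [_|d IHd ltdk].
  rewrite subn0.
  have -> : adj (a (W k)) y = (y == W k).
    apply: (can_inj oddb); rewrite forced.
    by case: (b (W k)) path_end => // _; rewrite addn0.
  apply: (iffP eqP) => [->|[i]]; first by exists k; rewrite ?leqnn.
  by rewrite -eqn_leq => /eqP->.
set e := k - d.+1; have eS : k - d = e.+1 by rewrite subnSK.
have ltek : e < k by rewrite -eS leq_subr.
have Nnext := adj_upper_next y (path_inner ltek); rewrite -/(W e.+1) in Nnext.
have -> : adj (a (W e)) y = (y == W e) || adj (a (W e.+1)) y.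
  by move: Nnext; case: eqP; case: (adj (a (W e.+1)) y); case: (adj _ _).
have {}IHd := IHd (ltnW ltdk); rewrite eS in IHd.
apply: (iffP orP) => [[/eqP->|/IHd[i /andP[ltei leik] ->]]|].
- by exists e; rewrite ?leqnn ?(ltnW ltek).
- by exists i; rewrite ?(ltnW ltei).
- case=> i /andP[]; rewrite leq_eqVlt => /orP[/eqP ei|ltei] leik ey.
    by left; rewrite ei ey.
  by right; apply/IHd; exists i; rewrite ?ltei.
Qed.

Lemma path_inj (i j : nat) : i <= k -> j <= k -> W i = W j -> i = j.
Proof.
move=> leik lejk eW; apply: succn_inj.
rewrite -(@degree_path i) => [|m ltm]; last exact/path_inner/(leq_trans ltm).
by rewrite eW degree_path // => m ltm; apply/path_inner/(leq_trans ltm).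
Qed.

(** If a(w_i) = w_j, then a(w_0), being adjacent to w_j, is a neighbour of
    a(w_i), hence some w_s; but a(w_0) is adjacent to every w_s, so to
    itself. *)
Lemma upper_path_disjoint (i j : nat) : i <= k -> j <= k -> a (W i) <> W j.
Proof.
move=> leik lejk eij.
have : adj (a (W i)) (a (W 0)) by rewrite eij; apply/adj_path => //; exists 0.
case/(adj_upper_path _ leik) => s /andP[_ lesk] es.
have : adj (a (W 0)) (W s) by apply/adj_upper_path => //; exists s.
by rewrite -es adj_irrefl.
Qed.

Definition path_map (x : half_graph k.+1) : G :=
  match x with inl i => a (W i) | inr j => W j end.

Lemma path_map_adj (x y : half_graph k.+1) :
  adj (path_map x) (path_map y) = adj x y.
Proof.
have ub (i : 'I_k.+1) : i <= k by rewrite -ltnS ltn_ord.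
have cross (i j : 'I_k.+1) : adj (a (W i)) (W j) = (i <= j).
  apply/adj_upper_path/idP => [|[s /andP[leis lesk]]|leij]; first exact: ub.
    by move/path_inj => -> //; apply: ub.
  by exists j; rewrite // leij ub.
case: x y => [i|i] [j|j] /=; rewrite ?cross //.
- apply/negP => /(adj_upper_path _ (ub i))[s /andP[_ lesk]].
  exact: upper_path_disjoint (ub j) lesk.
- by rewrite adj_sym cross.
- apply/negP => /(adj_path _ (ub i))[s lesi] /esym.
  exact: upper_path_disjoint (leq_trans lesi (ub i)) (ub j).
Qed.

Lemma path_map_inj : injective path_map.
Proof.
have ub (i : 'I_k.+1) : i <= k by rewrite -ltnS ltn_ord.
move=> [i|i] [j|j] /= e.
- by congr inl; apply/val_inj/path_inj; rewrite ?ub //;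
    apply: (inv_inj upper_involutive).
- by case: (upper_path_disjoint (ub i) (ub j)).
- by case: (upper_path_disjoint (ub j) (ub i)).
- by congr inr; apply/val_inj/path_inj; rewrite ?ub.
Qed.

Lemma path_map_closed (x : half_graph k.+1) (v : G) :
  adj (path_map x) v -> exists y, v = path_map y.
Proof.
case: x => i /=.
  case/(adj_upper_path _ (ltn_ord i)) => s /andP[_ lesk] ->.
  by exists (inr (Ordinal (lesk : s < k.+1))).
case/(adj_path _ (ltn_ord i)) => s lesi ->.
by exists (inl (Ordinal (leq_ltn_trans lesi (ltn_ord i)))).
Qed.

(** By [path_map_closed], a walk starting on the path never leaves its image. *)
Lemma path_map_onto (v : G) : connected G -> exists y, v = path_map y.
Proof.
move=> /(_ w0 v)/connectP[p]; have : exists y, w0 = path_map y.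
  by exists (inr ord0).
elim: p (w0) => [|u p IHp] w [x ->] /=; first by move=> _ ->; exists x.
by case/andP=> /path_map_closed/IHp.
Qed.

Lemma path_isomorphic : connected G -> isomorphic G (half_graph k.+1).
Proof.
move=> conG; have [|g fK gK] := @inj_card_bij _ _ path_map path_map_inj.
  rewrite -(card_codom path_map_inj); apply/subset_leq_card/subsetP => v _.
  by have [y ->] := path_map_onto v conG; apply: codom_f.
exists g; first by exists path_map.
by move=> x y; rewrite -path_map_adj !gK.
Qed.

End ForcingPairs.

Theorem theorem1 (G : sgraph) (n : nat) (G_nonempty : 0 < #|G|)
    (G_order : #|G| = n) (G_connected : connected G)
    (G_locatable : locatable G) :
  gamma_OL G = n <-> exists k : nat, 1 <= k /\ isomorphic G (half_graph k).
Proof.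
have fullP := gamma_OL_fullP G_locatable.
rewrite -G_order; split=> [/fullP allF|[k [_ isoG]]]; last first.
  by apply/fullP; apply: isomorphic_forces isoG (@half_graph_forces k).
have [ab forced] := fin_all_exists allF.
have [w0 adj_w0] := exists_degree_one forced G_nonempty.
have [k [path_end path_inner]] := path_ends forced adj_w0.
exists k.+1; split=> //.
exact: (path_isomorphic forced adj_w0 path_end path_inner).
Qed.
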